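(* For every job $j\in J$, the start time $\sigma_j(y)$, i.e. the $j$th component of the map $\sigma:\mathbb{Z}_+^T\to\prod_{j\in J}[r_j,\infty)$ taking a vector of agent levels to the vector of first-come-first-serve start times, is a non-increasing function of $y$: if $y,\hat y\in\mathbb{Z}_+^T$ satisfy $y_t\le\hat y_t$ for all $t\in T$, then $\sigma_j(\hat y)\le\sigma_j(y)$.
   Context: Let $T=\{1,\dots,|T|\}$ be a finite set of time periods of common length $L>0$, where period $t$ is the half-open interval $[(t-1)L,tL)$ (this also defines periods $t>|T|$). Let $J=\{1,\dots,|J|\}$ be a finite set of jobs; job $j$ has release time $r_j\ge 0$ and processing time $\rho_j\ge 0$, and the jobs are sorted by release time, $r_1\le r_2\le\cdots$. A vector $y=(y_t)_{t\in T}\in\mathbb{Z}_+^T$ of non-negative integers gives the number of agents allocated to each time period; after the last period there are always $y_{\min}$ agents, i.e. set $y_t=y_{\min}$ for all $t>|T|$, where $y_{\min}\in\mathbb{Z}_+$ is a fixed constant (the minimum number of agents per period). Jobs are processed in first-come-first-serve order, each occupying one agent for its duration, and overtime is allowed (a started job is always finished even if the number of agents drops). For fixed $y$ the start times $\sigma_1(y),\sigma_2(y),\dots$ are defined recursively: given $\sigma_1(y),\dots,\sigma_{j-1}(y)$, let $$\kappa(\tau,j,y)=\bigl|\{j'\in J: j'<j,\ \sigma_{j'}(y)+\rho_{j'}>\tau\}\bigr|\qquad(\tau\in[0,\infty))$$ be the number of jobs before $j$ still being processed at time $\tau$, and let $\sigma_j(y)$ be the optimal value of the problem of minimising the real number $\tau$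 subject to $$\tau\ge\max\{\sigma_{j-1}(y),r_j\}\quad\text{and}\quad \kappa(\tau,j,y)<y_{t(\tau)},$$ where $t(\tau)=\lfloor\tau/L\rfloor+1$ is the index of the time period containing $\tau$ (for $j=1$ the first condition is just $\tau\ge r_1$). A minimisation problem that is infeasible has value $+\infty$ by convention; when all these problems are feasible, $\sigma_j(y)\in[r_j,\infty)$ for every $j$. *)

(* Defs.v *)
From HB Require Import structures.
From mathcomp Require Import all_boot all_order all_algebra.
From mathcomp Require Import boolp classical_sets reals constructive_ereal ereal.

Set Implicit Arguments.
Unset Strict Implicit.
Unset Printing Implicit Defensive.

Import Order.TTheory GRing.Theory Num.Theory.
Local Open Scope classical_set_scope.
Local Open Scope ring_scope.

(* Periods and jobs are numbered from 0: the ordinal t : 'I_nT is the period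
   [t * L, t.+1 * L), and the ordinal j : 'I_nJ is the (j.+1)-st job. *)

Definition period (R : realType) (L tau : R) : nat := Num.truncn (tau / L).

Definition agents (nT : nat) (ymin : nat) (y : 'I_nT -> nat) (t : nat) : nat :=
  if insub t is Some i then y i else ymin.

Section FCFS.
Context {R : realType} {nT nJ : nat}.
Variables (L : R) (r rho : 'I_nJ -> R) (ymin : nat) (y : 'I_nT -> nat).

(* Start times live in \bar R, since an infeasible problem has value +oo; a job
   whose start time is +oo is never finished and blocks all later jobs. *)
Implicit Type s : 'I_nJ -> \bar R.

Definition kappa s (j : 'I_nJ) (tau : R) : nat :=
  #|[pred i : 'I_nJ | (i < j)%N && (tau%:E < s i + (rho i)%:E)%E]|.

Definition feasible s (j : 'I_nJ) : set R :=
  [set tau | [/\ r j <= tau,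
                 forall i : 'I_nJ, i.+1 = j -> (s i <= tau%:E)%E &
                 (kappa s j tau < agents ymin y (period L tau))%N]].

(* The infimum of the empty set is +oo. *)
Definition opt_start s (j : 'I_nJ) : \bar R :=
  ereal_inf [set tau%:E | tau in feasible s j].

(* opt_start s j only reads s at indices below j, so k iterations from an
   arbitrary vector fix the first k start times; start_timeE is the defining
   recursion. *)
Definition start_time : 'I_nJ -> \bar R := iter nJ opt_start (fun=> +oo%E).

Lemma eq_opt_start s s' (j : 'I_nJ) :
  (forall i : 'I_nJ, (i < j)%N -> s i = s' i) -> opt_start s j = opt_start s' j.
Proof.
move=> ss'; rewrite /opt_start; congr (ereal_inf (_ @` _)).
have kE tau : kappa s j tau = kappa s' j tau.
  apply: eq_card => i; rewrite !inE /=.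
  by case: ltnP => //= ij; rewrite ss'.
apply/seteqP; split=> tau [rj prev cap]; split=> //.
- by move=> i ij; rewrite -ss' -?ij//; apply: prev.
- by rewrite -kE.
- by move=> i ij; rewrite ss' -?ij//; apply: prev.
- by rewrite kE.
Qed.

Lemma start_timeE (j : 'I_nJ) : start_time j = opt_start start_time j.
Proof.
have stable k (i : 'I_nJ) : (i < k)%N ->
    iter k opt_start (fun=> +oo%E) i = iter k.+1 opt_start (fun=> +oo%E) i.
  elim: k i => // k IH i; rewrite ltnS => ik.
  by apply: eq_opt_start => i' i'i; apply: IH; exact: leq_trans i'i ik.
exact: stable.
Qed.

End FCFS.

Arguments start_time {R nT nJ} L r rho ymin y j.

(* Main.v *)
Require Import Defs.
From HB Require Import structures.
From mathcomp Require Import all_boot all_order all_algebra.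
From mathcomp Require Import boolp classical_sets reals constructive_ereal ereal.

(** The start time of a job is an infimum over a set of times, and that set can
    only grow when agents are added. A time that is feasible for job j under y
    satisfies [r j <= tau], which does not involve y; it is not before the start
    of the previous job, a bound that relaxes if that job starts no later under
    yhat; and fewer than [y_t(tau)] earlier jobs are still running at tau. If
    every earlier job starts no later under yhat, it also ends no later, as its
    processing time is fixed, so no more of them are running at tau, while at
    least as many agents are present. Hence tau is feasible for j under yhat,
    and strong induction on j concludes. *)

Set Implicit Arguments.
Unset Strict Implicit.
Unset Printing Implicit Defensive.

Import Order.TTheory GRing.Theory Num.Theory.
Local Open Scope ring_scope.

Lemma leq_agents (nT ymin : nat) (y yhat : 'I_nT -> nat) (t : nat) :
  (forall u, (y u <= yhat u)%N) ->
  (agents ymin y t <= agents ymin yhat t)%N.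
Proof. by move=> le_y; rewrite /agents; case: insub. Qed.

Lemma leq_kappa (R : realType) (nJ : nat) (rho : 'I_nJ -> R)
    (s shat : 'I_nJ -> \bar R) (j : 'I_nJ) (tau : R) :
  (forall i : 'I_nJ, (i < j)%N -> (shat i <= s i)%E) ->
  (kappa rho shat j tau <= kappa rho s j tau)%N.
Proof.
move=> le_s; apply/subset_leq_card/fintype.subsetP => i; rewrite !inE.
case/andP=> ij running; rewrite ij /=.
by apply: lt_le_trans running _; apply: leeD2r; apply: le_s.
Qed.

(** The inductive step, which reduces to an inclusion of feasible sets because
    the infimum is antitone for inclusion. *)
Lemma le_opt_start (R : realType) (nT nJ : nat) (L : R) (r rho : 'I_nJ -> R)
    (ymin : nat) (y yhat : 'I_nT -> nat) (s shat : 'I_nJ -> \bar R)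
    (j : 'I_nJ) :
  (forall t, (y t <= yhat t)%N) ->
  (forall i : 'I_nJ, (i < j)%N -> (shat i <= s i)%E) ->
  (opt_start L r rho ymin yhat shat j <= opt_start L r rho ymin y s j)%E.
Proof.
move=> le_y le_s; apply/le_ereal_inf/image_subset => tau [rj prev cap].
split=> // [i ij|].
  by apply: le_trans (prev i ij); apply: le_s; rewrite -ij.
apply: leq_ltn_trans (leq_kappa _ _ le_s) _.
exact: leq_trans cap (leq_agents _ _ le_y).
Qed.

Theorem lemma4p1 (R : realType) (nT nJ : nat) (L : R) (r rho : 'I_nJ -> R)
    (ymin : nat)
    (L_gt0 : 0 < L)
    (r_ge0 : forall j, 0 <= r j)
    (rho_ge0 : forall j, 0 <= rho j)
    (r_sorted : forall i j : 'I_nJ, (i <= j)%N -> r i <= r j)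
    (y yhat : 'I_nT -> nat)
    (le_y_yhat : forall t, (y t <= yhat t)%N)
    (j : 'I_nJ) :
  (start_time L r rho ymin yhat j <= start_time L r rho ymin y j)%E.
Proof.
have [n] := ubnP (j : nat); elim: n j => // n IH j; rewrite ltnS => jn.
rewrite !start_timeE; apply: le_opt_start => // i ij.
by apply: IH; apply: leq_trans ij jn.
Qed.
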